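(* Let $n\ge 3$, let $\mathbf{a}=(a_1,\dots,a_r)$ be a sequence of positive integers with $\sum_{i=1}^r a_i=n$, let $X$ be the generic $3\times n$ matrix whose rows are $(x_1,\dots,x_n)$, $(y_1,\dots,y_n)$, $(z_1,\dots,z_n)$, and let $I_X\subset K[x_1,\dots,x_n,y_1,\dots,y_n,z_1,\dots,z_n]$ be the ideal generated by the maximal ($3\times 3$) minors of $X$. Let $M_{\mathbf{a}}$ be the matching field ideal of $\mathbf{a}$ and $\prec_{w_{\mathbf{a}}}$ the weight order associated with $\mathbf{a}$. Then $$M_{\mathbf{a}}=\mathrm{in}_{\prec_{w_{\mathbf{a}}}}(I_X).$$ In particular, the maximal minors of $X$ form a Gröbner basis for $I_X$ with respect to $\prec_{w_{\mathbf{a}}}$.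
   Context: $K$ is a field and the $x_i,y_i,z_i$ are independent variables. Put $\alpha_0=0$, $\alpha_t=\sum_{i=1}^t a_i$, and $I_t=\{\alpha_{t-1}+1,\dots,\alpha_t\}$ for $1\le t\le r$. Matching field ideal: for every $3$-subset $\{i<j<k\}$ of $[n]=\{1,\dots,n\}$ let $s$ be the minimal $t$ such that $I_t\cap\{i,j,k\}\ne\emptyset$, and set $$m_{\{ijk\}}=\begin{cases} x_jy_iz_k & \text{if } |\{i,j,k\}\cap I_s|=1,\\ x_iy_jz_k&\text{otherwise.}\end{cases}$$ $M_{\mathbf{a}}$ is the ideal generated by the monomials $m_{\{ijk\}}$ for all $3$-subsets of $[n]$. Weights: fix a real number $w_0>0$ and define weights $w_{\mathbf{a}}$ of the variables as follows. - $w_{\mathbf{a}}(x_i)=w_0$ for all $i$. - $w_{\mathbf{a}}(y_{\alpha_{r-1}+1})=w_0+1$; for $s<r$ and $j=\alpha_{s-1}+1$, $w_{\mathbf{a}}(y_j)=w_{\mathbf{a}}(y_{\alpha_{s+1}})+1$; for $j\in I_s$ with $j>\alpha_{s-1}+1$, $w_{\mathbf{a}}(y_j)=w_{\mathbf{a}}(y_{\alpha_{s-1}+1})+j-(\alpha_{s-1}+1)$. - $w_{\mathbf{a}}(z_1)=w_{\mathbf{a}}(z_2)=w_0$, and $w_{\mathbf{a}}(z_i)=w_{\mathbf{a}}(y_{\alpha_1})+(n-2)(i-2)$ for $3\le i\le n$. The weight of a monomial is the sum of the weights of its variables, counted with multiplicity. The order $\prec_{w_{\mathbf{a}}}$ is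 the monomial order in which $m<m'$ if the weight of $m$ is less than that of $m'$, or if the weights are equal and $m<m'$ in the reverse lexicographic order induced by $$z_n>\cdots>z_3>y_{\alpha_1}>\cdots>y_{\alpha_0+1}>y_{\alpha_2}>\cdots>y_{\alpha_1+1}>\cdots>y_{\alpha_r}>\cdots>y_{\alpha_{r-1}+1}>z_2>z_1>x_1>\cdots>x_n$$ (the $y$-variables are listed block by block, from $I_1$ to $I_r$, with decreasing indices inside each block). The initial term of a polynomial is its largest term with respect to this order, and $\mathrm{in}_{\prec_{w_{\mathbf{a}}}}(I_X)$ is the ideal generated by the initial terms of all nonzero elements of $I_X$. *)

(* Defs.v *)
From mathcomp Require Import all_boot all_order all_algebra.
From mathcomp Require Import reals.
From mathcomp Require Import mpoly.

Set Implicit Arguments.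
Unset Strict Implicit.
Unset Printing Implicit Defensive.

Import Order.TTheory GRing.Theory Num.Theory.
Local Open Scope ring_scope.

Definition ideal_gen (A : comNzRingType) (G : A -> Prop) (p : A) : Prop :=
  exists s : seq (A * A),
    (forall cg, cg \in s -> G cg.2) /\ p = \sum_(cg <- s) cg.1 * cg.2.

Section InitialIdeals.
Variables (N : nat) (K : fieldType) (lt : rel 'X_{1..N}).
Implicit Types (p : {mpoly K[N]}) (I : {mpoly K[N]} -> Prop).

(* [mlead] is tied to the fixed order of the library on ['X_{1..N}], hence this
   version for an arbitrary strict order [lt].  The default value [0%MM] is
   only reached for [p = 0] when [lt] is total. *)
Definition lead_mon p : 'X_{1..N} :=
  head 0%MM [seq m <- msupp p |
              all (fun m' => (m' == m) || lt m' m) (msupp p)].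

Definition initial_term p : {mpoly K[N]} := p@_(lead_mon p) *: 'X_[lead_mon p].

Definition initial_ideal I : {mpoly K[N]} -> Prop :=
  ideal_gen (fun t => exists p, [/\ I p, p != 0 & t = initial_term p]).

Definition is_groebner_basis (G : seq {mpoly K[N]}) I : Prop :=
  (forall g, g \in G -> I g) /\
  (forall p,
     ideal_gen (fun t => exists g, [/\ g \in G, g != 0 & t = initial_term g]) p
     <-> initial_ideal I p).

End InitialIdeals.

(* The variables are the entries of a 3 x n matrix.  A column is an [i : 'I_n],
   which stands for the mathematical index i + 1. *)
Definition xvar n (i : 'I_n) : 'I_(3 * n) := mxvec_index (@Ordinal 3 0 isT) i.
Definition yvar n (i : 'I_n) : 'I_(3 * n) := mxvec_index (@Ordinal 3 1 isT) i.
Definition zvar n (i : 'I_n) : 'I_(3 * n) := mxvec_index (@Ordinal 3 2 isT) i.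

Definition generic_matrix (K : fieldType) n : 'M[{mpoly K[3 * n]}]_(3, n) :=
  \matrix_(i < 3, j < n) 'X_(mxvec_index i j).

Definition triples n : seq ('I_n * 'I_n * 'I_n) :=
  [seq t : 'I_n * 'I_n * 'I_n <- enum {: 'I_n * 'I_n * 'I_n}
  | (t.1.1 < t.1.2 < t.2)%N].

Definition max_minor (K : fieldType) n (t : 'I_n * 'I_n * 'I_n) :
    {mpoly K[3 * n]} :=
  \det (colsub (tnth [tuple t.1.1; t.1.2; t.2]) (generic_matrix K n)).

Definition maximal_minors (K : fieldType) n : seq {mpoly K[3 * n]} :=
  [seq max_minor K t | t <- triples n].

Definition I_X (K : fieldType) n : {mpoly K[3 * n]} -> Prop :=
  ideal_gen (fun p => p \in maximal_minors K n).

Arguments I_X : clear implicits.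

Section Blocks.
Variable a : seq nat.

Definition alpha (t : nat) : nat := sumn (take t a).

(* The blocks are I_1, ..., I_r with r = size a; both t and j start from 1. *)
Definition in_block (t j : nat) : bool := (alpha t.-1 < j <= alpha t)%N.

Definition block n (t : nat) : {set 'I_n} := [set i : 'I_n | in_block t i.+1].

Definition block_of (j : nat) : nat :=
  head 0%N [seq t <- iota 1 (size a) | in_block t j].

Section MatchingField.
Variables (K : fieldType) (n : nat).

Definition first_block (S : {set 'I_n}) : nat :=
  head 0%N [seq t <- iota 1 (size a) | block n t :&: S != set0].

Definition matching_monomial (t : 'I_n * 'I_n * 'I_n) : {mpoly K[3 * n]} :=
  let: (i, j, k) := t in
  let S := [set i; j; k] in
  if #|S :&: block n (first_block S)| == 1%N
  then 'X_(xvar j) * 'X_(yvar i) * 'X_(zvar k)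
  else 'X_(xvar i) * 'X_(yvar j) * 'X_(zvar k).

Definition matching_ideal : {mpoly K[3 * n]} -> Prop :=
  ideal_gen (fun p => p \in [seq matching_monomial t | t <- triples n]).

End MatchingField.

Section Weights.
Variables (R : realType) (w0 : R).

(* [weight_y_start_rec d] is the weight of y_(alpha_(s-1) + 1) for s = r - d.
   In the recursive case w(y_(alpha_(s+1))) is expanded as
   w(y_(alpha_s + 1)) + (alpha_(s+1) - (alpha_s + 1)); see
   [weight_y_start_block]. *)
Fixpoint weight_y_start_rec (d : nat) : R :=
  if d is d'.+1 then
    let s := (size a - d)%N in
    weight_y_start_rec d' + (alpha s.+1 - (alpha s).+1)%:R + 1
  else w0 + 1.

Definition weight_y_start (s : nat) : R := weight_y_start_rec (size a - s).

Definition weight_y (j : nat) : R :=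
  let s := block_of j in weight_y_start s + (j - (alpha s.-1).+1)%:R.

Definition weight_z (n i : nat) : R :=
  if (i <= 2)%N then w0 else weight_y (alpha 1) + ((n - 2) * (i - 2))%:R.

Definition mon_weight n (m : 'X_{1..3 * n}) : R :=
  \sum_(i < n) (w0 *+ m (xvar i) + weight_y i.+1 *+ m (yvar i)
                + weight_z n i.+1 *+ m (zvar i)).

End Weights.

(* The variables in decreasing order. *)
Definition var_list n : seq 'I_(3 * n) :=
  [seq zvar i | i : 'I_n <- rev (enum 'I_n) & (3 <= i.+1)%N]
  ++ flatten [seq [seq yvar i | i : 'I_n <- rev (enum 'I_n) & i \in block n t]
             | t <- iota 1 (size a)]
  ++ [seq zvar i | i : 'I_n <- rev (enum 'I_n) & (i.+1 <= 2)%N]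
  ++ [seq xvar i | i <- enum 'I_n].

(* [index] increases when the variable decreases: [v] is the smallest variable
   at which [m] and [m'] differ. *)
Definition revlex_lt n (m m' : 'X_{1..3 * n}) : bool :=
  let rk v := index v (var_list n) in
  (mdeg m < mdeg m')%N
  || (mdeg m == mdeg m')
     && [exists v : 'I_(3 * n), (m' v < m v)%N &&
          [forall u : 'I_(3 * n), (rk v < rk u)%N ==> (m u == m' u)]].

Definition weight_lt (R : realType) (w0 : R) n (m m' : 'X_{1..3 * n}) : bool :=
  (mon_weight w0 m < mon_weight w0 m')
  || (mon_weight w0 m == mon_weight w0 m') && revlex_lt m m'.

End Blocks.

Arguments matching_ideal a K n : clear implicits.
Arguments weight_lt a {R} w0 n.

Section Sanity.
Variables (R : realType) (a : seq nat) (w0 : R).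
Hypothesis a_gt0 : all (fun t => 0 < t)%N a.

Lemma alphaS t : (t < size a)%N -> alpha a t.+1 = (alpha a t + nth 0%N a t)%N.
Proof.
by move=> ht; rewrite /alpha (take_nth 0%N ht) -cats1 sumn_cat /= addn0.
Qed.

Lemma alpha_lt t : (t < size a)%N -> (alpha a t < alpha a t.+1)%N.
Proof.
move=> ht; rewrite alphaS // -[X in (X < _)%N]addn0 ltn_add2l.
exact: (allP a_gt0) (mem_nth _ ht).
Qed.

Lemma alpha_le t u : (t <= u)%N -> (alpha a t <= alpha a u)%N.
Proof.
move=> tu; rewrite /alpha -(subnKC tu) takeD sumn_cat; exact: leq_addr.
Qed.

Lemma block_of_in s j :
  (1 <= s <= size a)%N -> in_block a s j -> block_of a j = s.
Proof.
move=> /andP[s1 sr] js; rewrite /block_of.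
have uni t : in_block a t j -> (1 <= t)%N -> t = s.
  move=> /andP[t1 t2] t0; case/andP: js => s2 s3.
  case: (ltngtP t s) => // lt.
  - have h : (alpha a t <= alpha a s.-1)%N.
      by apply: alpha_le; rewrite -ltnS prednK.
    by rewrite leqNgt (leq_trans s2 t2) in h.
  - have h : (alpha a s <= alpha a t.-1)%N.
      by apply: alpha_le; rewrite -ltnS prednK.
    by rewrite leqNgt (leq_trans t1 s3) in h.
have : s \in [seq t <- iota 1 (size a) | in_block a t j].
  by rewrite mem_filter js mem_iota s1 add1n ltnS sr.
case E: [seq t <- _ | _] => [|t l] //= _.
have : t \in [seq t <- iota 1 (size a) | in_block a t j].
  by rewrite E mem_head.
by rewrite mem_filter mem_iota => /and3P[/uni h /h].
Qed.

Lemma weight_y_block s j : (1 <= s <= size a)%N -> in_block a s j ->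
  weight_y a w0 j =
  weight_y a w0 (alpha a s.-1).+1 + (j - (alpha a s.-1).+1)%:R.
Proof.
move=> hs js; rewrite /weight_y (block_of_in hs js).
rewrite (@block_of_in s (alpha a s.-1).+1) ?subnn ?addr0 //.
case/andP: hs => s1 sr; rewrite /in_block leqnn /=.
by rewrite -{2}(prednK s1) alpha_lt // prednK.
Qed.

Lemma weight_y_start_last : (0 < size a)%N ->
  weight_y a w0 (alpha a (size a).-1).+1 = w0 + 1.
Proof.
move=> r0; rewrite /weight_y (@block_of_in (size a)) ?r0 ?leqnn //.
  by rewrite /weight_y_start !subnn /= addr0.
by rewrite /in_block leqnn -{2}(prednK r0) alpha_lt // prednK.
Qed.

Lemma weight_y_start_block s : (1 <= s < size a)%N ->
  weight_y a w0 (alpha a s.-1).+1 = weight_y a w0 (alpha a s.+1) + 1.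
Proof.
move=> /andP[s1 sr].
rewrite {1}/weight_y (@block_of_in s) ?s1 ?(ltnW sr) //; last first.
  by rewrite /in_block leqnn -{2}(prednK s1) alpha_lt // prednK // ltnW.
rewrite subnn addr0 /weight_y (@block_of_in s.+1) //; last first.
  by rewrite /in_block leqnn alpha_lt.
rewrite /weight_y_start -(subnSK sr) /= (subnSK sr) subKn //; exact: ltnW.
Qed.

End Sanity.

(* Main.v *)
Require Import Defs.
From mathcomp Require Import all_boot all_order all_algebra.
From mathcomp Require Import reals.
From mathcomp Require Import mpoly.
From mathcomp Require Import ring zify.
Import Order.TTheory GRing.Theory Num.Theory.
Local Open Scope ring_scope.

(** Every variable weighs [w0] plus a natural number: [0] for [x_j], [Y_j] for
    [y_j], [Z_j] for [z_j].  On polynomials that are homogeneous for the total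
    degree, the real weight thus compares monomials as an integral weight does.

    The numbers [Z_j] grow so much faster than the [Y_j] that, for columns
    [p, q < r] with [Y_p < Y_q], the monomial [x_p y_q z_r] strictly outweighs
    the five other terms of the minor on the columns [p, q, r].  The order
    given by the [Y_j] runs through the blocks from the last to the first and
    increases inside each block, so [x_p y_q z_r] is exactly the matching
    monomial ([initial_term_max_minor], [matching_monomialE]).  This gives the
    inclusion of the matching field ideal in the initial ideal, with initial
    terms of minors only.

    For the other inclusion, let [m0] be a monomial that no matching monomial
    divides.  Reading off which rows of which columns occur in [m0], one finds
    two columns [u < v] such that, for every other column [j], the entry of
    column [j] in the matching monomial of [{u, v, j}] does not divide [m0]
    ([monomial_avoiding_minors]).  Call this entry the missing entry of [j].
    These pairs of columns describe the minimal primes of the matching field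
    ideal: each is generated by the missing entries.

    Given [u] and [v], degenerate the generic matrix: multiply each variable
    by [t] to the power its integral weight, keep all entries but the missing ones, and
    solve the linear equation [det (u, v, j) = 0] for the missing entry of each
    column [j].  The result has rank two, hence kills [I_X].  As the missing
    entry stands in the heaviest term of that determinant, its solution has
    [t]-degree strictly below its weight.  So if [p] in [I_X] had [m0] among
    its monomials of maximal weight, the top coefficient in [t] of the
    image of its homogeneous component of degree [deg m0], which vanishes, would
    be a nonzero multiple of a combination of distinct monomials, one of which
    is [m0] with its nonzero coefficient: a contradiction
    ([mcoeff_eq0_of_degeneration]).  Hence the initial term of
    every element of [I_X] is divisible by a matching monomial. *)

(** * Integral weights of the columns *)

Section ColumnWeights.
Variable a : seq nat.
Local Notation n := (sumn a).

(** The weight of [y_j] is [w0 + ywt j].  The first summand counts the columns of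
    the blocks after that of [j], the second is the rank of [j] in its block, so
    [ywt] is a bijection of the columns onto [1, ..., n]. *)
Definition ywt (j : nat) : nat :=
  let s := block_of a j in (n - alpha a s + (j - alpha a s.-1))%N.

(** The weight of [z_j] is [w0 + zwt j]; the [n] is [ywt] of the last column of
    the first block. *)
Definition zwt (j : nat) : nat :=
  if (j <= 2)%N then 0%N else (n + (n - 2) * (j - 2))%N.

Lemma alpha_size : alpha a (size a) = n.
Proof. by rewrite /alpha take_size. Qed.

Lemma alpha_le_sumn s : (alpha a s <= n)%N.
Proof.
rewrite -alpha_size; case: (leqP s (size a)) => hs; first exact: alpha_le.
by rewrite /alpha !take_oversize // ltnW.
Qed.

Lemma block_ofP j : (0 < j <= n)%N ->
  (1 <= block_of a j <= size a)%N && in_block a (block_of a j) j.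
Proof.
case/andP=> j0 jn.
have [s hs js] : exists2 s, (1 <= s <= size a)%N & in_block a s j.
  have ex_s : exists s, (j <= alpha a s)%N by exists (size a); rewrite alpha_size.
  have [s js smin] := ex_minnP ex_s; exists s.
    rewrite smin ?alpha_size // andbT lt0n; apply: contraL js => /eqP->.
    by rewrite /alpha take0 /= -ltnNge.
  rewrite /in_block js andbT ltnNge; apply/negP => /smin.
  case: s js {smin} => [|s _]; last by rewrite ltnn.
  by rewrite /alpha take0 leqNgt j0.
by rewrite (block_of_in hs js) hs js.
Qed.

Lemma block_of_le i j : (0 < i)%N -> (i <= j)%N -> (j <= n)%N ->
  (block_of a i <= block_of a j)%N.
Proof.
move=> i0 ij jn; rewrite leqNgt; apply/negP => bji.
have /block_ofP/andP[_ /andP[hi _]] : (0 < i <= n)%N by lia.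
have /block_ofP/andP[_ /andP[_ hj]] : (0 < j <= n)%N by lia.
have : (alpha a (block_of a j) <= alpha a (block_of a i).-1)%N.
  by apply: alpha_le; lia.
lia.
Qed.

Lemma ywt_bounds j : (0 < j <= n)%N -> (0 < ywt j <= n)%N.
Proof.
move=> hj; have /andP[/andP[s1 _] /andP[h1 h2]] := block_ofP _ hj.
by have := alpha_le_sumn (block_of a j); rewrite /ywt; lia.
Qed.

Lemma ywt_same_block i j : (0 < i)%N -> (i <= j)%N -> (j <= n)%N ->
  block_of a i = block_of a j -> (ywt j = ywt i + (j - i))%N.
Proof.
move=> i0 ij jn bij.
have /block_ofP/andP[_ /andP[hi _]] : (0 < i <= n)%N by lia.
by rewrite /ywt -bij; lia.
Qed.

Lemma ywt_earlier_block i j : (0 < i)%N -> (i <= j)%N -> (j <= n)%N ->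
  (block_of a i < block_of a j)%N -> (ywt j < ywt i)%N.
Proof.
move=> i0 ij jn bij.
have /block_ofP/andP[_ /andP[hi hi']] : (0 < i <= n)%N by lia.
have /block_ofP/andP[_ /andP[hj hj']] : (0 < j <= n)%N by lia.
have h : (alpha a (block_of a i) <= alpha a (block_of a j).-1)%N.
  by apply: alpha_le; lia.
have := alpha_le_sumn (block_of a j); rewrite /ywt; lia.
Qed.

(** Between blocks, [ywt] decreases; this is the dichotomy in the definition of
    the matching field. *)
Lemma ywt_lt i j : (0 < i)%N -> (i < j)%N -> (j <= n)%N ->
  (ywt j < ywt i)%N = (block_of a i != block_of a j).
Proof.
move=> i0 ij jn; have := block_of_le i j i0 (ltnW ij) jn.
rewrite leq_eqVlt => /orP[/eqP bij|bij].
  by have := ywt_same_block i j i0 (ltnW ij) jn bij; rewrite bij eqxx; lia.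
by rewrite (ywt_earlier_block i j) ?(ltnW ij) // ltn_eqF.
Qed.

Lemma ywt_growth i j : (0 < i)%N -> (i < j)%N -> (j <= n)%N ->
  (ywt j <= ywt i + (j - i))%N.
Proof.
move=> i0 ij jn; have := block_of_le i j i0 (ltnW ij) jn.
rewrite leq_eqVlt => /orP[/eqP|] bij.
  by rewrite (ywt_same_block i j) // ltnW.
by have := ywt_earlier_block i j i0 (ltnW ij) jn bij; lia.
Qed.

Lemma ywt_neq i j : (0 < i)%N -> (i < j)%N -> (j <= n)%N -> ywt i != ywt j.
Proof.
move=> i0 ij jn; have := block_of_le i j i0 (ltnW ij) jn.
rewrite leq_eqVlt => /orP[/eqP|] bij.
  by have := ywt_same_block i j i0 (ltnW ij) jn bij; lia.
by have := ywt_earlier_block i j i0 (ltnW ij) jn bij; lia.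
Qed.

Lemma zwt_lt i j : (i < j)%N -> (2 < j)%N -> (j <= n)%N -> (zwt i < zwt j)%N.
Proof.
move=> ij j2 jn; rewrite /zwt (leqNgt j) j2 /=.
by case: (leqP i 2) => hi; nia.
Qed.

(** The growth of [ywt] between two columns is at most their distance, whereas
    each step of [zwt] past the second column is at least [n - 2].  The latter is
    larger as soon as [3 <= i < j <= n]; for [i <= 2] the constant [n] in [zwt j]
    does the work. *)
Lemma zwt_dominates i j : (0 < i)%N -> (i < j)%N -> (2 < j)%N -> (j <= n)%N ->
  (ywt j + zwt i < ywt i + zwt j)%N.
Proof.
move=> i0 ij j2 jn; rewrite /zwt (leqNgt j) j2 /=.
have := ywt_growth i j i0 ij jn.
have := ywt_bounds i; have := ywt_bounds j.
case: (leqP i 2) => hi; first nia.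
have -> : (j - 2 = (i - 2) + (j - i))%N by lia.
rewrite mulnDr; nia.
Qed.

Hypothesis a_gt0 : all (fun t => 0 < t)%N a.

Lemma weight_y_start_rec_nat (R : realType) (w0 : R) d : (d < size a)%N ->
  weight_y_start_rec a w0 d = w0 + (n - alpha a (size a - d)).+1%:R.
Proof.
elim: d => [|d IHd] d_lt /=; first by rewrite subn0 alpha_size subnn.
rewrite IHd ?(ltnW d_lt) // (_ : (size a - d.+1).+1 = (size a - d))%N; last lia.
rewrite -addrA natr1 -addrA -natrD; congr (_ + _%:R).
have := alpha_lt a_gt0 (t := (size a - d.+1)%N).
rewrite (_ : (size a - d.+1).+1 = (size a - d))%N; last lia.
have := alpha_le_sumn (size a - d); lia.
Qed.

Lemma weight_y_nat (R : realType) (w0 : R) j : (0 < j <= n)%N ->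
  weight_y a w0 j = w0 + (ywt j)%:R.
Proof.
move=> hj; have /andP[/andP[s1 s2] /andP[h1 h2]] := block_ofP _ hj.
rewrite /weight_y /weight_y_start weight_y_start_rec_nat; last lia.
rewrite subKn // -addrA -natrD; congr (_ + _%:R); rewrite /ywt; lia.
Qed.

Lemma weight_z_nat (R : realType) (w0 : R) j : (0 < n)%N ->
  weight_z a w0 n j = w0 + (zwt j)%:R.
Proof.
move=> n0; rewrite /weight_z /zwt; case: ifP => _; first by rewrite addr0.
have s1 : (0 < size a)%N by move: n0; case: (a).
have a1 := alpha_lt a_gt0 s1.
rewrite weight_y_nat; last by rewrite alpha_le_sumn andbT; lia.
rewrite -addrA -natrD; congr (_ + (_ + _)%:R).
rewrite /ywt (@block_of_in a 1) ?s1 //; last by rewrite /in_block a1 /=.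
have := alpha_le_sumn 1; have -> : alpha a 1.-1 = 0%N by rewrite /alpha take0.
lia.
Qed.
End ColumnWeights.

(** * Monomials in the entries of the matrix *)

Local Notation row_x := (@Ordinal 3 0 isT).
Local Notation row_y := (@Ordinal 3 1 isT).
Local Notation row_z := (@Ordinal 3 2 isT).

Section ThreeRows.
Variable n : nat.

Lemma sum_vars (V : nmodType) (F : 'I_(3 * n) -> V) :
  \sum_v F v = \sum_(j < n) (F (xvar j) + F (yvar j) + F (zvar j)).
Proof.
rewrite (reindex _ (curry_mxvec_bij _ _)) /=.
rewrite (eq_bigr (fun rj => F (mxvec_index rj.1 rj.2))); last by case.
rewrite -(pair_big xpredT xpredT (fun r j => F (mxvec_index r j))) /=.
rewrite !big_ord_recl big_ord0 addr0 -!big_split /=.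
apply: eq_bigr => j _; rewrite addrA.
congr (_ + _ + _); congr (F (mxvec_index _ _)); exact: val_inj.
Qed.

Lemma det_mx33 (A : comNzRingType) (M : 'M[A]_3) :
  \det M =
    M row_x row_x * (M row_y row_y * M row_z row_z - M row_y row_z * M row_z row_y)
  - M row_x row_y * (M row_y row_x * M row_z row_z - M row_y row_z * M row_z row_x)
  + M row_x row_z * (M row_y row_x * M row_z row_y - M row_y row_y * M row_z row_x).
Proof.
pose f (r c : nat) := M (inord r) (inord c).
have fE r c : M r c = f r c by rewrite /f !inord_val.
rewrite (expand_det_row _ row_x) !big_ord_recl big_ord0 /cofactor /=.
rewrite !(expand_det_row _ 0) !big_ord_recl !big_ord0 /cofactor !det_mx11.
rewrite !mxE !fE /= /bump /= ?addn0 ?add0n ?addn1 ?expr0 ?expr1 ?expr2.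
by ring.
Qed.

Definition xyz (p q r : 'I_n) : 'X_{1..3 * n} :=
  (U_(xvar p) + U_(yvar q) + U_(zvar r))%MM.

Lemma mdeg_xyz p q r : mdeg (xyz p q r) = 3.
Proof. by rewrite !mdegD !mdeg1. Qed.

Lemma mpolyX_xyz (K : fieldType) p q r :
  'X_[xyz p q r] = 'X_(xvar p) * 'X_(yvar q) * 'X_(zvar r) :> {mpoly K[3 * n]}.
Proof. by rewrite !mpolyXD. Qed.

Lemma max_minorE (K : fieldType) (i j k : 'I_n) :
  max_minor K (i, j, k) =
    'X_[xyz i j k] - 'X_[xyz i k j] - 'X_[xyz j i k]
    + 'X_[xyz j k i] + 'X_[xyz k i j] - 'X_[xyz k j i].
Proof. by rewrite /max_minor det_mx33 !mpolyX_xyz !mxE /xvar /yvar /zvar; ring. Qed.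

Lemma mxvec_index_eq (r r' : 'I_3) (j j' : 'I_n) :
  (mxvec_index r j == mxvec_index r' j') = (r == r') && (j == j').
Proof.
by rewrite /mxvec_index (inj_eq (@cast_ord_inj _ _ _)) (inj_eq enum_rank_inj).
Qed.

Lemma xyz_le p q r (m : 'X_{1..3 * n}) :
  (0 < m (xvar p))%N -> (0 < m (yvar q))%N -> (0 < m (zvar r))%N ->
  (xyz p q r <= m)%MM.
Proof.
move=> mp mq mr; apply/mnm_lepP => v; rewrite !mnmDE !mnm1E.
case: eqP => [<-|_]; first by rewrite !mxvec_index_eq.
case: eqP => [<-|_]; first by rewrite !mxvec_index_eq.
by case: eqP => [<-|_].
Qed.

Definition monwt (w : 'M[nat]_(3, n)) (m : 'X_{1..3 * n}) : nat :=
  (\sum_v mxvec w 0%R v * m v)%N.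

Lemma monwtE (w : 'M[nat]_(3, n)) m : monwt w m =
  (\sum_(j < n) (w row_x j * m (xvar j) + w row_y j * m (yvar j)
                 + w row_z j * m (zvar j)))%N.
Proof. by rewrite [LHS]sum_vars; apply: eq_bigr => j _; rewrite !mxvecE. Qed.

Lemma monwt_xyz w p q r :
  monwt w (xyz p q r) = (w row_x p + w row_y q + w row_z r)%N.
Proof.
have wU v : (\sum_u mxvec w 0%R u * (U_(v)%MM : 'X_{1..3 * n}) u)%N = mxvec w 0%R v.
  rewrite (bigD1 v) //= mnm1E eqxx muln1 big1 ?addn0 // => u uv.
  by rewrite mnm1E eq_sym (negbTE uv) muln0.
rewrite -!(mxvecE w) -!wU -!big_split; apply: eq_bigr => v _.
by rewrite !mnmDE !mulnDr.
Qed.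

End ThreeRows.

(** * Matching monomials are the initial terms of the minors *)

Section LeadingTerms.
Variable a : seq nat.
Local Notation n := (sumn a).
Variables (K : fieldType) (R : realType) (w0 : R).

Definition colwt : 'M[nat]_(3, n) :=
  \matrix_(r, j) nth 0%N [:: 0%N; ywt a j.+1; zwt a j.+1] r.

Lemma mon_weight_nat m : all (fun t => 0 < t)%N a ->
  mon_weight a w0 m = w0 *+ mdeg m + (monwt n colwt m)%:R.
Proof.
move=> a_gt0; rewrite mdegE sum_vars monwtE natr_sum -sumrMnr -big_split /=.
apply: eq_bigr => j _; rewrite weight_y_nat ?ltn_ord // weight_z_nat //; last first.
  exact: leq_ltn_trans (ltn_ord j).
rewrite !mxE /= !mulrnDl mul0n add0n natrD !natrM !mulr_natr !mulrnDr.
by ring.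
Qed.

Lemma lead_mon_unique (p : {mpoly K[3 * n]}) m : m \in msupp p ->
  {in msupp p, forall m', m' != m -> mon_weight a w0 m' < mon_weight a w0 m} ->
  lead_mon (weight_lt a w0 n) p = m.
Proof.
move=> mp m_max; rewrite /lead_mon; set s := filter _ _.
have s_m m' : m' \in s -> m' = m.
  rewrite mem_filter => /andP[/allP/(_ m mp) + m'p].
  have [->//|m'm /=] := eqVneq m' m.
  have lt := m_max _ m'p m'm.
  by rewrite /weight_lt lt_gtF //= gt_eqF.
have : m \in s.
  rewrite mem_filter mp andbT; apply/allP => m' m'p.
  by case: (eqVneq m' m) => //= m'm; rewrite /weight_lt m_max.
by case: s s_m => [|m' s] s_m // _; rewrite /= (s_m m') ?mem_head.
Qed.

(** The first alternative is the default value of [lead_mon]; for a polynomial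
    without constant term it makes the initial term zero. *)
Lemma lead_mon_weight_max (p : {mpoly K[3 * n]}) :
  lead_mon (weight_lt a w0 n) p = 0%MM \/
  lead_mon (weight_lt a w0 n) p \in msupp p /\
  {in msupp p, forall m,
     mon_weight a w0 m <= mon_weight a w0 (lead_mon (weight_lt a w0 n) p)}.
Proof.
rewrite /lead_mon; set s := filter _ _.
have: forall m, m \in s -> m \in msupp p /\ {in msupp p, forall m',
     mon_weight a w0 m' <= mon_weight a w0 m}.
  move=> m; rewrite mem_filter => /andP[/allP m_max mp]; split=> // m' m'p.
  case/predU1P: (m_max _ m'p) => [->//|/orP[/ltW//|/andP[/eqP-> _]]] //.
by case: s => [|m s] max_s; [left | right; apply: max_s; rewrite mem_head].
Qed.

End LeadingTerms.

Section MinorLeadingTerms.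
Variable a : seq nat.
Local Notation n := (sumn a).
Variables (K : fieldType) (R : realType) (w0 : R).

(** Exponent of the matching monomial; the case distinction on blocks becomes a
    comparison of the weights of [y_i] and [y_j]. *)
Definition matching_exponent (i j k : 'I_n) : 'X_{1..3 * n} :=
  if (ywt a j.+1 < ywt a i.+1)%N then xyz n j i k else xyz n i j k.

Lemma matching_monomialE (i j k : 'I_n) : (i < j < k)%N ->
  matching_monomial a K (i, j, k) = 'X_[matching_exponent i j k].
Proof.
case/andP=> ij jk.
have in_blockE (l : 'I_n) t : (1 <= t <= size a)%N ->
    (l \in block a n t) = (block_of a l.+1 == t).
  move=> ht; rewrite inE; apply/idP/eqP => [h|<-]; first exact: block_of_in ht h.
  by case/andP: (block_ofP a l.+1 (ltn_ord l)).
have /andP[/andP[s1 s_a] _] := block_ofP a i.+1 (ltn_ord i).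
have bij : (block_of a i.+1 <= block_of a j.+1)%N.
  by apply: block_of_le => //; exact: ltnW.
have bjk : (block_of a j.+1 <= block_of a k.+1)%N.
  by apply: block_of_le => //; exact: ltnW.
rewrite /matching_exponent (ywt_lt a) // /matching_monomial.
have -> /= : first_block a [set i; j; k] = block_of a i.+1.
  rewrite /first_block.
  (* No block before that of [i] meets the triple, as [i] is its least element. *)
  have -> : iota 1 (size a) = iota 1 (block_of a i.+1).-1
      ++ block_of a i.+1 :: iota (block_of a i.+1).+1 (size a - block_of a i.+1).
    have -> : size a = ((block_of a i.+1).-1 + (size a - block_of a i.+1).+1)%N by lia.
    rewrite iotaD /= add1n prednK //; congr (_ ++ _ :: iota _ _); lia.
  rewrite filter_cat (_ : [seq _ <- iota 1 _ | _] = [::]) /=.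
    rewrite ifT //; apply/set0Pn; exists i.
    by rewrite in_setI in_blockE ?s1 // !inE !eqxx.
  apply/eqP; rewrite -[_ == _]negbK -has_filter -all_predC; apply/allP => t.
  rewrite mem_iota /= => ht; apply/negPn/set0Pn => -[l].
  rewrite in_setI in_blockE; last lia.
  by rewrite !inE => /andP[/eqP bl /orP[/orP[]|] /eqP el]; move: bl; rewrite el; lia.
(* If [i] and [j] share the first block, both are counted; otherwise only [i] is. *)
have [bij_eq|bij_neq] := eqVneq (block_of a i.+1) (block_of a j.+1).
  rewrite ifF ?mpolyX_xyz //; apply/negbTE; rewrite gtn_eqF //.
  apply: (@leq_trans #|[set i; j]|).
    by rewrite cards2 neq_ltn ij.
  apply/subset_leq_card/subsetP => l; rewrite !inE -!/(in_block _ _ _).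
  case/orP => /eqP->; rewrite eqxx ?orbT /=.
    by case/andP: (block_ofP a i.+1 (ltn_ord i)).
  by rewrite bij_eq; case/andP: (block_ofP a j.+1 (ltn_ord j)).
rewrite ifT ?mpolyX_xyz //; apply/cards1P; exists i.
apply/setP => l; rewrite in_setI in_blockE ?s1 // !inE.
have [->|li] := eqVneq l i; first by rewrite !eqxx.
apply/negbTE/negP => /andP[/orP[]/eqP-> /eqP]; last lia.
by move/eqP; rewrite eq_sym (negbTE bij_neq).
Qed.

Lemma colwt_xyz p q r :
  monwt n (colwt a) (xyz n p q r) = (ywt a q.+1 + zwt a r.+1)%N.
Proof. by rewrite monwt_xyz !mxE. Qed.

(** The term with [z_k] beats those with [z_i] and [z_j] by [zwt_dominates] and
    the monotonicity of [zwt]; the two terms with [z_k] are separated by the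
    weights of [y_i] and [y_j]. *)
Lemma max_minor_support (i j k : 'I_n) (m : 'X_{1..3 * n}) : (i < j < k)%N ->
  let m0 := matching_exponent i j k in
  ((max_minor K (i, j, k))@_m0 != 0) /\
  (m \in msupp (max_minor K (i, j, k)) -> m != m0 ->
   mdeg m = 3 /\ (monwt n (colwt a) m < monwt n (colwt a) m0)%N).
Proof.
case/andP=> ij jk /=.
have yij : ywt a i.+1 != ywt a j.+1 by apply: ywt_neq.
have zik : (zwt a i.+1 < zwt a k.+1)%N by apply: zwt_lt => //; lia.
have zjk : (zwt a j.+1 < zwt a k.+1)%N by apply: zwt_lt => //; lia.
have dik : (ywt a k.+1 + zwt a i.+1 < ywt a i.+1 + zwt a k.+1)%N.
  by apply: zwt_dominates => //; lia.
have djk : (ywt a k.+1 + zwt a j.+1 < ywt a j.+1 + zwt a k.+1)%N.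
  by apply: zwt_dominates => //; lia.
have wtE := colwt_xyz.
have neq m1 m2 :
    (monwt n (colwt a) m1 < monwt n (colwt a) m2)%N -> (m1 == m2) = false.
  by move=> lt; apply: contraTF lt => /eqP->; rewrite ltnn.
split.
  rewrite max_minorE !(mcoeffD, mcoeffN, mcoeffX).
  rewrite /matching_exponent; case: ifP => y_lt; rewrite eqxx !neq ?wtE; try lia.
    by rewrite !(sub0r, oppr0, addr0) oppr_eq0 oner_eq0.
  by rewrite !(subr0, addr0) oner_eq0.
move=> mp mm0.
have : m \in [:: xyz n i j k; xyz n i k j; xyz n j i k; xyz n j k i; xyz n k i j; xyz n k j i].
  move: mp; rewrite mcoeff_msupp max_minorE !(mcoeffD, mcoeffN, mcoeffX).
  apply: contraTT; rewrite !inE !negb_or ![m == _]eq_sym.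
  do 5![case/andP=> /negbTE->]; move/negbTE->.
  by rewrite !subr0 !addr0 eqxx.
rewrite !inE => m_six; split.
  by case/or3P: m_six => [/eqP->|/eqP->|/or4P[]/eqP->]; rewrite mdeg_xyz.
case/or3P: m_six mm0 => [/eqP->|/eqP->|/or4P[]/eqP->];
  rewrite /matching_exponent; case: ifP => y_lt;
  by rewrite ?eqxx // !wtE => _; lia.
Qed.

Lemma max_minor_neq0 (i j k : 'I_n) : (i < j < k)%N -> max_minor K (i, j, k) != 0.
Proof.
by case/(max_minor_support _ _ _ 0%MM) => + _; apply: contraNneq => ->; rewrite mcoeff0.
Qed.

Lemma initial_term_max_minor (i j k : 'I_n) :
  all (fun t => 0 < t)%N a -> (i < j < k)%N ->
  let m0 := matching_exponent i j k in
  initial_term (weight_lt a w0 n) (max_minor K (i, j, k)) =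
    (max_minor K (i, j, k))@_m0 *: 'X_[m0].
Proof.
move=> a_gt0 ijk m0; rewrite /initial_term (@lead_mon_unique a K R w0 _ m0) //.
  by rewrite mcoeff_msupp; case: (max_minor_support _ _ _ 0%MM ijk).
move=> m mp mm0; have [_ /(_ mp mm0)[dm lt_m]] := max_minor_support _ _ _ m ijk.
rewrite !mon_weight_nat // dm /m0 (_ : mdeg _ = 3); last first.
  by rewrite /matching_exponent; case: ifP; rewrite mdeg_xyz.
by rewrite ltrD2l ltr_nat.
Qed.

End MinorLeadingTerms.

(** * Rank two degenerations of the generic matrix *)

Lemma eq0_of_left_kernel (B : idomainType) m (l : 'rV[B]_m) (M : 'M[B]_m) :
  l != 0 -> l *m M = 0 -> \det M = 0.
Proof.
move=> l0 lM; have : \det M *: l = 0.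
  by rewrite -mul_mx_scalar -mul_mx_adj mulmxA lM mul0mx.
move=> dl; apply/eqP; apply: contraNT l0 => detM; apply/eqP/rowP => j.
move/rowP/(_ j)/eqP: dl; rewrite !mxE mulf_eq0 (negbTE detM) /=.
by move/eqP.
Qed.

Section Specialisation.
Variables (K : fieldType) (n : nat).

(** A matrix with a nonzero left kernel vector has rank at most two, so all its
    maximal minors vanish. *)
Lemma mmap_I_X (B : idomainType) (f : {rmorphism K -> B}) (M : 'M[B]_(3, n))
    (l : 'rV[B]_3) p :
  l != 0 -> l *m M = 0 -> I_X K n p -> mmap f (mxvec M 0) p = 0.
Proof.
move=> l0 lM [s [s_minors ->]]; rewrite rmorph_sum big1_seq //= => cg /s_minors.
case/mapP => -[[i j] k] _ -> {s_minors}; rewrite rmorphM /= /max_minor -det_map_mx.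
set M' := map_mx _ _; suff -> : \det M' = 0 by rewrite mulr0.
have -> : M' = colsub (tnth [tuple i; j; k]) M.
  apply/matrixP => r c; rewrite !mxE.
  by rewrite [LHS]mmapX mmap1U mxvecE.
apply: (eq0_of_left_kernel _ _ l) => //.
by rewrite mulmx_colsub lM; apply/matrixP => r c; rewrite !mxE.
Qed.

(** The ideal is homogeneous, so each homogeneous component of [p] vanishes too.
    Scaling [M] by a new variable separates the components without leaving the
    matrices of rank two. *)
Lemma mmap_I_X_homog (B : idomainType) (f : {rmorphism K -> B}) (M : 'M[B]_(3, n))
    (l : 'rV[B]_3) p d :
  l != 0 -> l *m M = 0 -> I_X K n p ->
  \sum_(m <- msupp p | mdeg m == d) f p@_m * mmap1 (mxvec M 0) m = 0.
Proof.
move=> l0 lM pI.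
have lP0 : map_mx polyC l != 0.
  by apply: contraNneq l0 => /(congr1 (map_mx (coefp 0))) /matrixP e;
     apply/eqP/matrixP => r c; have := e r c; rewrite !mxE /= coefC eqxx coef0.
have := @mmap_I_X {poly B} (polyC \o f) ('X *: map_mx polyC M) (map_mx polyC l) p lP0.
rewrite -scalemxAr -map_mxM lM map_mx0 scaler0 => /(_ erefl pI).
move=> /(congr1 (coefp d)) /= top; rewrite coef0 in top; rewrite -[RHS]top.
rewrite /mmap coef_sum [LHS]big_mkcond; apply: eq_bigr => m _ /=.
have -> : mmap1 (mxvec ('X *: map_mx polyC M) 0) m =
    'X^(mdeg m) * (mmap1 (mxvec M 0) m)%:P.
  rewrite /mmap1 mdegE -prodrXr rmorph_prod -big_split /=; apply: eq_bigr => v _.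
  by case/mxvec_indexP: v => r c; rewrite !mxvecE !mxE rmorphXn -exprMn.
rewrite /= mulrCA -polyCM coefMC coefXn [d == _]eq_sym.
by case: eqP; rewrite ?mul1r ?mul0r.
Qed.

End Specialisation.

Lemma top_coefM (A : idomainType) (p q : {poly A}) c d :
  (size p <= c.+1)%N -> (size q <= d.+1)%N ->
  (size (p * q)%R <= (c + d).+1)%N /\ (p * q)`_(c + d) = p`_c * q`_d.
Proof.
move=> sp sq; split.
  by apply: leq_trans (size_polyMleq _ _) _; lia.
rewrite coefM (bigD1 (inord c)) //= inordK ?ltnS ?leq_addr // addKn.
rewrite big1 ?addr0 // => i ic; have [lt|ge] := ltnP i c.
  by rewrite [q`_ _]nth_default ?mulr0 //; apply: leq_trans sq _; lia.
rewrite nth_default ?mul0r //; apply: leq_trans sp _.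
rewrite ltn_neqAle ge andbT; apply: contraNneq ic => ci.
by apply/eqP/val_inj; rewrite /= inordK // ci // ltnS leq_addr.
Qed.

(** If each variable is sent to a polynomial of degree at most [e v], the top
    coefficient of a monomial is the monomial in the top coefficients. *)
Lemma mmap1_top_coef (N : nat) (A : idomainType) (h : 'I_N -> {poly A})
    (e : 'I_N -> nat) (m : 'X_{1..N}) :
  (forall v, size (h v) <= (e v).+1)%N ->
  (size (mmap1 h m) <= (\sum_v e v * m v).+1)%N /\
  (mmap1 h m)`_(\sum_v e v * m v) = mmap1 (fun v => (h v)`_(e v)) m.
Proof.
move=> he; rewrite /mmap1.
pose P (x : {poly A}) (d : nat) (y : A) := (size x <= d.+1)%N /\ x`_d = y.
apply: (big_ind3 P).
- by rewrite /P size_poly1 coef1.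
- move=> x1 x2 d1 d2 y1 y2 [s1 c1] [s2 c2].
  by have [] := top_coefM _ _ _ _ _ s1 s2; rewrite /P c1 c2.
move=> v _; elim: (m v) => [|k [sk ck]].
  by rewrite /P muln0 !expr0 size_poly1 coef1.
by have [] := top_coefM _ _ _ _ _ (he v) sk; rewrite /P mulnS !exprS ck.
Qed.

Section Degeneration.
Variables (K : fieldType) (n : nat) (w : 'M[nat]_(3, n)).
Local Notation A := {mpoly K[3 * n]}.

Definition weighted_generic : 'M[{poly A}]_(3, n) :=
  \matrix_(r, j) ('X_(mxvec_index r j) *: 'X^(w r j)).

Local Notation G := weighted_generic.

(** The vector [l] is orthogonal to the full columns; the other columns are made
    orthogonal to [l] by solving for their missing entry.  The last hypothesis
    says that this lowers the degree of the missing entry. *)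
Variables (full : pred 'I_n) (missing : 'I_n -> 'I_3) (l : 'I_3 -> {poly A}).
Hypothesis l_neq0 : forall r, l r != 0.
Hypothesis l_full : forall j, full j -> \sum_r l r * G r j = 0.
Hypothesis l_missing : forall j r, ~~ full j -> r != missing j ->
  (size (l r) + w r j < size (l (missing j)) + w (missing j) j)%N.

(* The solution for the missing entry has denominator [l (missing j)]; clearing
   it by [Delta] in all columns alike multiplies each homogeneous component by a
   power of [Delta]. *)
Let Delta := \prod_r l r.
Let D := (size Delta).-1.
Let is_missing r j := ~~ full j && (r == missing j).

Let completion : 'M[{poly A}]_(3, n) := \matrix_(r, j)
  if is_missing r j then - ((\prod_(s | s != r) l s) * \sum_(s | s != r) l s * G s j)
  else Delta * G r j.

Let Delta_neq0 : Delta != 0.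
Proof. by apply/prodf_neq0. Qed.

Let sizeDelta : size Delta = D.+1.
Proof. by rewrite /D prednK // size_poly_gt0. Qed.

Let sizeG r j : size (G r j) = (w r j).+1.
Proof.
by rewrite mxE size_scale ?size_polyXn // -msupp_eq0 msuppX.
Qed.

Let completion_kernel : (\row_r l r) *m completion = 0.
Proof.
apply/rowP => j; rewrite mxE [RHS]mxE.
under eq_bigr => r _ do rewrite [(\row__ _) _ _]mxE [completion r j]mxE /is_missing.
have [fj|fj] /= := boolP (full j).
  under eq_bigr => r _ do rewrite mulrCA.
  by rewrite -mulr_sumr l_full // mulr0.
have DeltaE : l (missing j) * (\prod_(s | s != missing j) l s) = Delta.
  by rewrite /Delta [RHS](bigD1 (missing j)).
rewrite (bigD1 (missing j)) //= eqxx mulrN mulrA DeltaE.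
rewrite mulr_sumr -sumrN -big_split big1 //= => r rj.
by rewrite (negbTE rj) (mulrCA (l r) Delta) addNr.
Qed.

Let completion_top r j :
  (size (completion r j) <= (D + w r j).+1)%N /\
  (completion r j)`_(D + w r j) =
    if is_missing r j then 0 else lead_coef Delta * 'X_(mxvec_index r j).
Proof.
rewrite [completion r j]mxE; case: ifPn => [/andP[fj /eqP->]|_]; last first.
  have sG : (size (G r j) <= (w r j).+1)%N by rewrite sizeG.
  have sDelta : (size Delta <= D.+1)%N by rewrite sizeDelta.
  have [-> ->] := top_coefM _ _ _ _ _ sDelta sG.
  by split=> //; rewrite lead_coefE mxE coefZ coefXn eqxx mulr1.
set q := - _; suff sq : (size q <= D + w (missing j) j)%N.
  by rewrite (leq_trans sq) //; split=> //; rewrite nth_default.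
rewrite /q size_polyN mulr_sumr; apply: leq_trans (size_sum _ _ _) _.
apply/bigmax_leqP => s sj; have := l_missing j s fj sj.
have : (size (\prod_(s | s != missing j) l s)%R + size (l (missing j)) = D.+2)%N.
  rewrite -sizeDelta /Delta [in RHS](bigD1 (missing j)) //= mulrC size_mul //.
    by rewrite prednK // addn_gt0 [(0 < size (l _))%N]size_poly_gt0 l_neq0 orbT.
  by apply/prodf_neq0.
set P := \prod_(s | _) _; have := size_polyMleq P (l s * G s j).
have := size_polyMleq (l s) (G s j); rewrite sizeG.
have : (0 < size (l s))%N by rewrite size_poly_gt0.
move: (size (P * _)) (size (l s * _)) (size P) (size (l s)) (size (l _)) => *; lia.
Qed.

(** Specialise [p] to the completed matrix and take the coefficient of the
    highest power of the grading variable that the monomials of degree [mdeg m0]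
    can reach.  Only those of maximal weight without missing entries contribute,
    and each contributes itself times the same nonzero factor. *)
Lemma mcoeff_eq0_of_degeneration (p : A) (m0 : 'X_{1..3 * n}) :
  I_X K n p ->
  {in msupp p, forall m, mdeg m = mdeg m0 -> (monwt n w m <= monwt n w m0)%N} ->
  (forall j, ~~ full j -> m0 (mxvec_index (missing j) j) = 0%N) ->
  p@_m0 = 0.
Proof.
move=> pI m0_max m0_full.
have [m0p|] := boolP (m0 \in msupp p); last by rewrite -mcoeff_eq0 => /eqP.
(* [restr m] is the image of [m] when the missing variables are set to zero. *)
pose kept v := ~~ (mxvec (\matrix_(r, j) is_missing r j) 0 v).
pose restr m : A := mmap1 (fun v => if kept v then 'X_v else 0) m.
have restrE m : restr m = 'X_[m] \/ restr m = 0 /\ m != m0.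
  have [/forallP km|] := boolP [forall v, kept v || (m v == 0%N)].
    left; rewrite /restr /mmap1 mpolyXE_id; apply: eq_bigr => v _.
    by have := km v; case: (kept v) => //= /eqP->; rewrite !expr0.
  rewrite negb_forall => /existsP[v]; rewrite negb_or => /andP[kv mv]; right.
  split.
    by rewrite /restr /mmap1 (bigD1 v) //= (negbTE kv) expr0n (negbTE mv) mul0r.
  apply: contraNneq mv => ->; move: kv; rewrite /kept negbK.
  by case/mxvec_indexP: v => r j; rewrite mxvecE mxE => /andP[fj /eqP->]; rewrite m0_full.
have hE v : (size (mxvec completion 0%R v) <= (D + mxvec w 0%R v).+1)%N /\
    (mxvec completion 0%R v)`_(D + mxvec w 0%R v) =
      lead_coef Delta * (if kept v then 'X_v else 0).
  rewrite /kept; case/mxvec_indexP: v => r j; rewrite !mxvecE mxE.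
  by have [? ->] := completion_top r j; split=> //; case: is_missing; rewrite ?mulr0.
have topE m : (mmap1 (mxvec completion 0%R) m)`_(D * mdeg m + monwt n w m) =
      lead_coef Delta ^+ mdeg m * restr m /\
    (size (mmap1 (mxvec completion 0%R) m) <= (D * mdeg m + monwt n w m).+1)%N.
  have [] := mmap1_top_coef _ _ (mxvec completion 0%R)
    (fun v => (D + mxvec w 0%R v)%N) m (fun v => (hE v).1).
  have -> : (\sum_v (D + mxvec w 0%R v) * m v = D * mdeg m + monwt n w m)%N.
    rewrite mdegE big_distrr -big_split; apply: eq_bigr => v _.
    exact: mulnDl.
  move=> sz ->; split=> //; rewrite /restr /mmap1 mdegE -prodrXr -big_split /=.
  by apply: eq_bigr => v _; rewrite (hE v).2 exprMn.
have l_row : (\row_r l r) != 0.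
  by apply/eqP => /rowP/(_ ord0)/eqP; rewrite !mxE (negbTE (l_neq0 _)).
have := @mmap_I_X_homog K n {poly A} (polyC \o (@mpolyC (3 * n) K)) completion
  _ p (mdeg m0) l_row completion_kernel pI.
move/(congr1 (coefp (D * mdeg m0 + monwt n w m0))); rewrite /= coef0 coef_sum.
have -> : \sum_(m <- msupp p | mdeg m == mdeg m0)
     (((p@_m)%:MP)%:P * mmap1 (mxvec completion 0%R) m)`_(D * mdeg m0 + monwt n w m0)
   = lead_coef Delta ^+ mdeg m0 *
     \sum_(m <- msupp p | (mdeg m == mdeg m0) && (monwt n w m == monwt n w m0))
        (p@_m)%:MP * restr m.
  rewrite mulr_sumr big_mkcondr big_seq_cond [RHS]big_seq_cond.
  apply: eq_bigr => m /andP[mp /eqP dm]; rewrite coefCM.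
  have [] := topE m; rewrite dm => top sz.
  have := m0_max m mp dm; rewrite leq_eqVlt => /predU1P[wm|wm].
    by rewrite wm eqxx -wm top mulrCA.
  rewrite (ltn_eqF wm) nth_default ?mulr0 //.
  by apply: leq_trans sz _; rewrite ltn_add2l.
move/eqP; rewrite mulf_eq0 expf_eq0 lead_coef_eq0 (negbTE Delta_neq0) andbF /=.
move/eqP/(congr1 (mcoeff m0)); rewrite mcoeff0 raddf_sum /=.
rewrite big_mkcond (bigD1_seq m0) ?msupp_uniq //= !eqxx mcoeffCM.
rewrite big1 ?addr0.
  by case: (restrE m0) => [->|[_]]; rewrite ?eqxx // mcoeffX eqxx mulr1.
move=> m mm0; case: ifP => // _; rewrite mcoeffCM.
by case: (restrE m) => [->|[-> _]]; rewrite ?mcoeff0 ?mulr0 // mcoeffX (negbTE mm0) mulr0.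
Qed.

End Degeneration.

Lemma row3P (P : 'I_3 -> Prop) : P row_x -> P row_y -> P row_z -> forall r, P r.
Proof.
move=> Px Py Pz [[|[|[|//]]] r3].
- by rewrite (_ : Ordinal r3 = row_x) //; apply: val_inj.
- by rewrite (_ : Ordinal r3 = row_y) //; apply: val_inj.
- by rewrite (_ : Ordinal r3 = row_z) //; apply: val_inj.
Qed.

(** The coefficients differ, so nothing cancels even when [i = j]. *)
Lemma size_binomial (A : idomainType) (c d : A) (i j : nat) :
  c != 0 -> d != 0 -> c != d -> size (c *: 'X^i - d *: 'X^j) = (maxn i j).+1.
Proof.
move=> c0 d0 cd; apply/eqP; rewrite eqn_leq; apply/andP; split.
  apply: leq_trans (size_polyD _ _) _.
  by rewrite size_polyN !size_scale // !size_polyXn -maxnSS.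
rewrite ltnNge; apply/negP => /leq_sizeP/(_ _ (leqnn _))/eqP; apply/negP.
rewrite coefB !coefZ !coefXn.
case: (ltngtP i j) => [ij|ji|->].
- by rewrite eqxx gtn_eqF // mulr0 mulr1 sub0r oppr_eq0.
- by rewrite eqxx gtn_eqF // mulr0 mulr1 subr0.
by rewrite eqxx !mulr1 subr_eq0.
Qed.

Section CrossProduct.
Variables (K : fieldType) (n : nat) (w : 'M[nat]_(3, n)) (u v : 'I_n).
Hypothesis uv : u != v.
Local Notation G := (weighted_generic K n w).

Let minor2 (r s : 'I_3) := G r u * G s v - G s u * G r v.

Definition cross (r : 'I_3) : {poly {mpoly K[3 * n]}} :=
  nth 0 [:: minor2 row_y row_z; minor2 row_z row_x; minor2 row_x row_y] r.

Lemma cross_orthogonal j : (j == u) || (j == v) -> \sum_r cross r * G r j = 0.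
Proof.
have -> : \sum_r cross r * G r j =
    cross row_x * G row_x j + cross row_y * G row_y j + cross row_z * G row_z j.
  rewrite !big_ord_recl big_ord0 addr0 addrA.
  by congr (_ + _ + _); congr (cross _ * G _ _); exact: val_inj.
by rewrite /cross /minor2 /=; case/orP => /eqP->; ring.
Qed.

Let size_minor2 r s : r != s ->
  size (minor2 r s) = (maxn (w r u + w s v) (w s u + w r v)).+1.
Proof.
move=> rs; rewrite /minor2 !mxE -!scalerAl -!scalerAr !scalerA -!exprD -!mpolyXD.
have X0 m : 'X_[m] != 0 :> {mpoly K[3 * n]} by rewrite -msupp_eq0 msuppX.
rewrite size_binomial //; apply/eqP => /(congr1 (mcoeff _)) e.
move: (e (U_(mxvec_index r u) + U_(mxvec_index s v))%MM).
rewrite !mcoeffX eqxx; case: eqP => [/mnmP/(_ (mxvec_index r u))|_ /eqP].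
  rewrite !mnmDE !mnm1E !mxvec_index_eq !eqxx [s == r]eq_sym (negbTE rs).
  by rewrite [v == u]eq_sym (negbTE uv) !andbF.
by rewrite oner_eq0.
Qed.

Lemma size_cross :
  [/\ size (cross row_x) = (maxn (w row_y u + w row_z v) (w row_z u + w row_y v)).+1,
      size (cross row_y) = (maxn (w row_z u + w row_x v) (w row_x u + w row_z v)).+1 &
      size (cross row_z) = (maxn (w row_x u + w row_y v) (w row_y u + w row_x v)).+1].
Proof. by split; apply: size_minor2. Qed.

Lemma cross_neq0 r : cross r != 0.
Proof.
have [sx sy sz] := size_cross; rewrite -size_poly_gt0.
by elim/row3P: r; rewrite ?sx ?sy ?sz.
Qed.

End CrossProduct.

(** * Initial monomials are divisible by matching monomials *)

(** The sets [A], [B], [C] stand for the rows [x], [y], [z] of the support of a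
    monomial, and the hypothesis says that no matching monomial divides it.
    Take for [v] the last column of [C].  Among the columns before [v], no
    element of [A] has a smaller [Y] than an element of [B], so the element [u]
    of [B] with the largest [Y] separates [B] from [A]. *)
Lemma monomial_avoiding_minors (n : nat) (Y : 'I_n -> nat) (A B C : pred 'I_n) :
  (1 < n)%N ->
  (forall p q r : 'I_n, A p -> B q -> C r -> (p < r)%N -> (q < r)%N -> (Y q <= Y p)%N) ->
  exists u v : 'I_n, [/\ (u < v)%N,
    forall j : 'I_n, (v < j)%N -> ~~ C j,
    forall j : 'I_n, (j < v)%N -> (Y j < Y u)%N -> ~~ A j &
    forall j : 'I_n, (j < v)%N -> (Y u < Y j)%N -> ~~ B j].
Proof.
move=> n1 avoid.
(* Adding the second column to [C], and dropping the first, guarantees a column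
   before [v].  If [v] is the second column, then [u] is the only one before it
   and the last two conditions are void. *)
pose c0 := Ordinal (ltnW n1); pose c1 := Ordinal n1.
have [v [v0 Cv vC]] : exists v : 'I_n, [/\ (0 < v)%N,
   forall j : 'I_n, (v < j)%N -> ~~ C j & (1 < v)%N -> C v].
  pose P := [pred v : 'I_n | (0 < v)%N && (C v || (v == c1))].
  have Pc1 : P c1 by rewrite /= eqxx orbT.
  case: (arg_maxnP (fun v : 'I_n => v : nat) Pc1) => v /andP[v0 Cv] vmax.
  exists v; split=> // [j vj|v1]; last first.
    by case/orP: Cv => // /eqP vE; rewrite vE in v1.
  apply/negP => Cj; have := vmax j; rewrite /= Cj (leq_ltn_trans _ vj) //= => /(_ isT).
  by rewrite leqNgt vj.
have [v1|v_le1] := ltnP 1 v; last first.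
  exists c0, v; split=> // j jv.
    by rewrite (_ : j = c0) ?ltnn //; apply: val_inj => /=; lia.
  by rewrite (_ : j = c0) ?ltnn //; apply: val_inj => /=; lia.
pose Bv := [pred q : 'I_n | (q < v)%N && B q].
case: (pickP Bv) => [q0 Bq0|noB].
  case: (arg_maxnP Y Bq0) => u /andP[uv Bu] umax.
  exists u, v; split=> // j jv Yj; apply/negP => Hj.
    by have := avoid j u v Hj Bu (vC v1) jv uv; rewrite leqNgt Yj.
  by have := umax j; rewrite /= jv Hj => /(_ isT); rewrite /= leqNgt Yj.
(* With no [B] before [v], any column before [v] that is least for [Y] will do. *)
have c0v : [pred j : 'I_n | (j < v)%N] c0 by [].
case: (arg_minnP Y c0v) => u /= uv umin.
exists u, v; split=> // j jv Yj; last by have /= := noB j; rewrite jv /= => ->.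
by have := umin j jv; rewrite leqNgt Yj.
Qed.

Section GroebnerBasis.
Variable a : seq nat.
Hypothesis a_gt0 : all (fun t => 0 < t)%N a.
Local Notation n := (sumn a).
Hypothesis n_gt2 : (2 < n)%N.
Variables (K : fieldType) (R : realType) (w0 : R).

Lemma ywt_inj : injective (fun i : 'I_n => ywt a i.+1).
Proof.
move=> i j /eqP e; apply: val_inj; apply/eqP; apply: contraTT e => ij.
have [lt|lt|eij] := ltngtP i j; first exact: ywt_neq.
  by rewrite eq_sym; exact: ywt_neq.
by case/eqP: ij.
Qed.

(** Otherwise [monomial_avoiding_minors] yields columns [u] and [v] for which the
    degeneration applies, the left kernel vector being the cross product of
    these columns. *)
Lemma matching_divides_top_monomial (p : {mpoly K[3 * n]}) (m0 : 'X_{1..3 * n}) :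
  I_X K n p -> m0 \in msupp p ->
  {in msupp p, forall m, mon_weight a w0 m <= mon_weight a w0 m0} ->
  exists i j k : 'I_n, (i < j < k)%N /\ (matching_exponent a i j k <= m0)%MM.
Proof.
move=> pI m0p m0_max.
have [/existsP[i /existsP[j /existsP[k /andP[]]]]|none] := boolP [exists i : 'I_n,
    exists j : 'I_n, exists k : 'I_n,
    (i < j < k)%N && (matching_exponent a i j k <= m0)%MM].
  by exists i, j, k.
have no_match (i j k : 'I_n) : (i < j)%N -> (j < k)%N ->
    (matching_exponent a i j k <= m0)%MM -> False.
  move=> ij jk le_m0; case/negP: none; apply/existsP; exists i.
  by apply/existsP; exists j; apply/existsP; exists k; rewrite ij jk.
pose Y (i : 'I_n) := ywt a i.+1; pose Z (i : 'I_n) := zwt a i.+1.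
have [p' q' r' Ap Bq Cr pr qr|] := @monomial_avoiding_minors n Y
    (fun i => 0 < m0 (xvar i))%N (fun i => 0 < m0 (yvar i))%N
    (fun i => 0 < m0 (zvar i))%N (ltnW n_gt2).
  rewrite leqNgt; apply/negP => Ypq.
  have le_m0 := xyz_le _ _ _ _ _ Ap Bq Cr.
  have [pq|qp|/val_inj epq] := ltngtP p' q'; last by rewrite epq ltnn in Ypq.
    by apply: (no_match p' q' r') => //; rewrite /matching_exponent ltnNge ltnW.
  by apply: (no_match q' p' r') => //; rewrite /matching_exponent Ypq.
move=> u [v [uv Cv Au Bu]].
have u_v : u != v by rewrite neq_ltn uv.
have [sx sy sz] := size_cross K n (colwt a) u v u_v.
move: m0p; rewrite mcoeff_msupp => /eqP[].
(* The entry of column [j] in the matching monomial of the columns [u, v, j]. *)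
pose missing (j : 'I_n) :=
  if (v < j)%N then row_z else if (Y j < Y u)%N then row_x else row_y.
have off j : ~~ ((j == u) || (j == v)) -> [/\ (j < v)%N || (v < j)%N, j != u & Y j != Y u].
  rewrite negb_or => /andP[ju jv]; split=> //.
    by rewrite -neq_ltn.
  by rewrite (inj_eq ywt_inj).
apply: (@mcoeff_eq0_of_degeneration K n (colwt a)
  (fun j => (j == u) || (j == v)) missing (cross K n (colwt a) u v)) => //.
- exact: cross_neq0.
- exact: cross_orthogonal.
- move=> j r /off[jv ju Yju]; rewrite /missing.
  have [zjv|zvj] := ltnP v j.
    have Zuj : (Z u < Z j)%N by apply: zwt_lt => //; lia.
    have Zvj : (Z v < Z j)%N by apply: zwt_lt => //; lia.
    have duj : (Y j + Z u < Y u + Z j)%N by apply: zwt_dominates => //; lia.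
    have dvj : (Y j + Z v < Y v + Z j)%N by apply: zwt_dominates => //; lia.
    elim/row3P: r => // _; rewrite ?sx ?sy ?sz !mxE /= -!/(Y _) -!/(Z _); lia.
  have {zvj}jv : (j < v)%N by case/orP: jv => //; rewrite ltnNge zvj.
  have v2 : (1 < v)%N.
    rewrite ltnNge; apply: contraNN ju => v1; apply/eqP/val_inj => /=; lia.
  have Zuv : (Z u < Z v)%N by apply: zwt_lt => //; lia.
  have Zjv : (Z j < Z v)%N by apply: zwt_lt => //; lia.
  have duv : (Y v + Z u < Y u + Z v)%N by apply: zwt_dominates => //; lia.
  have djv : (Y v + Z j < Y j + Z v)%N by apply: zwt_dominates => //; lia.
  case: ifP => Yj; elim/row3P: r => // _;
    rewrite ?sx ?sy ?sz !mxE /= -!/(Y _) -!/(Z _); lia.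
- move=> m mp dm; have := m0_max m mp.
  by rewrite !mon_weight_nat // dm lerD2l ler_nat.
move=> j /off[jv ju Yju]; rewrite /missing; apply/eqP; rewrite -leqn0 leqNgt.
have [vj|vj] := ltnP v j; first exact: Cv.
have {vj}jv : (j < v)%N by case/orP: jv => //; rewrite ltnNge vj.
case: ifP => Yj; first exact: Au.
by apply: Bu => //; rewrite ltn_neqAle eq_sym Yju leqNgt Yj.
Qed.

End GroebnerBasis.

(** * Comparison of the ideals *)

Section IdealGen.
Variable A : comNzRingType.
Implicit Types G H : A -> Prop.

Lemma ideal_gen_mul G c g : G g -> ideal_gen G (c * g).
Proof.
move=> Gg; exists [:: (c, g)]; split; last by rewrite big_seq1.
by move=> cg; rewrite inE => /eqP->.
Qed.

Lemma ideal_gen_sub G H : (forall g, G g -> ideal_gen H g) ->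
  forall p, ideal_gen G p -> ideal_gen H p.
Proof.
move=> GH p [s [Gs ->{p}]]; elim: s Gs => [|[c g] s IHs] Gs.
  by exists [::]; rewrite !big_nil.
have [s1 [Hs1 eg]] := GH _ (Gs (c, g) (mem_head _ _)).
have [|s2 [Hs2 es]] := IHs; first by move=> cg cgs; apply: Gs; rewrite inE cgs orbT.
exists ([seq (c * cg.1, cg.2) | cg <- s1] ++ s2); split.
  move=> cg; rewrite mem_cat => /orP[/mapP[cg' cgs1 ->]|]; last exact: Hs2.
  exact: Hs1 _ cgs1.
rewrite /= in eg; rewrite big_cons big_cat big_map -es /= [in LHS]eg mulr_sumr.
congr (_ + _).
by apply: eq_bigr => cg _; rewrite mulrA.
Qed.

End IdealGen.

Lemma I_X_no_constant_term (K : fieldType) n p : I_X K n p -> p@_0%MM = 0.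
Proof.
case=> s [s_minors ->]; rewrite raddf_sum big1_seq //= => cg /s_minors.
case/mapP => -[[i j] k] _ -> {s_minors}.
have m0 q r s' : (xyz n q r s' == 0%MM) = false.
  by apply/eqP => /(congr1 mdeg); rewrite mdeg_xyz mdeg0.
rewrite rmorphM /= max_minorE !(mcoeffD, mcoeffN, mcoeffX) !m0.
by rewrite !(subr0, addr0) mulr0.
Qed.

Theorem theorem1 (K : fieldType) (R : realType) (w0 : R) (n : nat) (a : seq nat)
    (hw0 : 0 < w0) (hn : (3 <= n)%N)
    (ha : all (fun t => 0 < t)%N a) (hsum : sumn a = n) :
  (forall p : {mpoly K[3 * n]},
     matching_ideal a K n p <-> initial_ideal (weight_lt a w0 n) (I_X K n) p)
  /\ is_groebner_basis (weight_lt a w0 n) (maximal_minors K n) (I_X K n).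
Proof.
subst n.
have triplesP i j k : ((i, j, k) \in triples (sumn a)) = (i < j < k)%N.
  by rewrite mem_filter mem_enum andbT.
have minorI g : g \in maximal_minors K (sumn a) -> I_X K (sumn a) g.
  by rewrite -[g]mul1r => gM; apply: ideal_gen_mul; rewrite -[g]mul1r.
set inM := ideal_gen (fun t => exists g,
  [/\ g \in maximal_minors K (sumn a), g != 0 & t = initial_term (weight_lt a w0 (sumn a)) g]).
have inM_initial p : inM p -> initial_ideal (weight_lt a w0 (sumn a)) (I_X K (sumn a)) p.
  apply: ideal_gen_sub => t [g [/minorI gI g0 ->]].
  by rewrite -[X in ideal_gen _ X]mul1r; apply: ideal_gen_mul; exists g.
have matching_inM p : matching_ideal a K (sumn a) p -> inM p.
  apply: ideal_gen_sub => t /mapP[[[i j] k]]; rewrite triplesP => ijk ->.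
  rewrite matching_monomialE //.
  have [c0 _] := max_minor_support a K i j k 0%MM ijk.
  rewrite -[X in ideal_gen _ X]scale1r -(mulVf c0) -scalerA.
  rewrite -(initial_term_max_minor a K R w0) // -mul_mpolyC.
  apply: ideal_gen_mul; exists (max_minor K (i, j, k)); split=> //.
    by apply/map_f; rewrite triplesP.
  exact: max_minor_neq0.
have initial_matching p : initial_ideal (weight_lt a w0 (sumn a)) (I_X K (sumn a)) p ->
    matching_ideal a K (sumn a) p.
  apply: ideal_gen_sub => t [g [gI _ ->]]; rewrite /initial_term.
  have [->|[m_g m_max]] := lead_mon_weight_max a K R w0 g.
    rewrite (I_X_no_constant_term _ _ _ gI) scale0r.
    by exists [::]; rewrite big_nil.
  have [i [j [k [ijk /submK <-]]]] :=
    matching_divides_top_monomial a ha hn K R w0 _ _ gI m_g m_max.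
  rewrite mpolyXD scalerAl; apply: ideal_gen_mul; apply/mapP; exists (i, j, k).
    by rewrite triplesP.
  by rewrite matching_monomialE.
split; first by move=> p; split=> [/matching_inM/inM_initial|/initial_matching].
split=> [//|p]; split; first exact: inM_initial.
by move/initial_matching/matching_inM.
Qed.
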